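(* Let $k\ge1$ and $n\ge 2^{k-1}+2$. Then the residues $\{f_w \bmod 2^k : w\in F_{\mathrm{odd}}(n)\}$ are equidistributed in $(\mathbf Z/2^k\mathbf Z)^*$; that is, the numbers $m_i=|\{w\in F_{\mathrm{odd}}(n) : f_w\equiv i \pmod{2^k}\}|$ are equal for all odd integers $1\le i\le 2^k-1$.
   Context: For $n\ge 0$, let $F(n)$ be the set of all words $w=x_1\dotsb x_l$ with each $x_i\in\{1,2\}$ and $\sum_i x_i=n$, and $F=\coprod_{n\ge0}F(n)$ ($F(0)$ contains only the empty word $\emptyset$). The Young–Fibonacci graph has vertex set $F$, with an edge between $v\in F(n)$ and $w\in F(n+1)$ (written $v\in w^-$) iff either (1) $v$ is obtained from $w$ by changing into a $1$ some $2$ of $w$ that has no $1$ to its left, or (2) $v$ is obtained from $w$ by removing its leftmost $1$. The $f$-statistic is defined by $f_\emptyset=1$ and $f_w=\sum_{v\in w^-}f_v$. $F_{\mathrm{odd}}(n)$ is the set of $w\in F(n)$ with $f_w$ odd. *)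

(* Defs.v *)
From mathcomp Require Import all_boot.

Set Implicit Arguments.
Unset Strict Implicit.
Unset Printing Implicit Defensive.

(* A word x_1 ... x_l is the sequence [:: x_1; ...; x_l]: "left" is the head. *)
Definition is_word (w : seq nat) : bool := all (mem [:: 1; 2]) w.

(* Duplicate-free enumeration of F(n): see [mem_F] and [uniq_F]. *)
Fixpoint F (n : nat) : seq (seq nat) :=
  match n with
  | 0 => [:: [::]]
  | 1 => [:: [:: 1]]
  | (m.+1 as n').+1 => [seq 1 :: w | w <- F n'] ++ [seq 2 :: w | w <- F m]
  end.

Lemma mem_F n w : (w \in F n) = is_word w && (sumn w == n).
Proof.
have cons_inP a (s : seq (seq nat)) b u :
  (b :: u \in [seq a :: w | w <- s]) = (b == a) && (u \in s).
  apply/mapP/andP => [[v vs [-> ->]] | [/eqP -> us]]; first by rewrite eqxx.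
  by exists u.
have nil_in a (s : seq (seq nat)) : ([::] \in [seq a :: w | w <- s]) = false.
  by apply/mapP => -[].
have [m] := ubnP n; elim: m n w => // m IHm [|[|n]] w ltnm.
- case: w => // a w; rewrite inE /is_word /= !inE.
  by case: a => [|a] //; rewrite andbF.
- case: w => [|[|[|[|a]]] w] //; rewrite inE /is_word /= ?inE ?eqE /= ?andbF //.
  case: w => [|[|a] w] //=; by rewrite !andbF.
- rewrite [F _]/= mem_cat; case: w => [|a w]; first by rewrite !nil_in.
  have lt1 : n.+1 < m by [].
  have lt0 : n < m by apply: ltnW.
  rewrite !cons_inP -/(F n.+1) IHm // IHm // /is_word /= !inE.
  case: a => [|[|[|a]]] //=; last by rewrite orbF.
Qed.

Lemma uniq_F n : uniq (F n).
Proof.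
have cons_inj a : injective (cons a : seq nat -> seq nat) by move=> u v [].
have [m] := ubnP n; elim: m n => // m IHm [|[|n]] // ltnm.
have lt1 : n.+1 < m by [].
have lt0 : n < m by apply: ltnW.
rewrite [F _]/= cat_uniq -/(F n.+1) !map_inj_uniq // !IHm // andbT /=.
by apply/hasPn => _ /mapP[u _ ->]; apply/mapP => -[].
Qed.

(* [change2 v w]: v is w with some 2 having no 1 to its left changed into a 1;
   [remove1 v w]: v is w without its leftmost 1 ([rem] deletes the first
   occurrence). *)
Definition change2 (v w : seq nat) : bool :=
  has (fun i => [&& nth 0 w i == 2, 1 \notin take i w & v == set_nth 0 w i 1])
      (iota 0 (size w)).

Definition remove1 (v w : seq nat) : bool := (1 \in w) && (v == rem 1 w).

(* v \in w^-, for v in F(n) and w in F(n+1) *)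
Definition edge (v w : seq nat) : bool := change2 v w || remove1 v w.

(* The recursion f_w = \sum_(v in w^-) f_v is well-founded on the weight
   n = sumn w; see [fstat_nil] and [fstatE] for the defining equations. *)
Fixpoint fstat_rec (n : nat) (w : seq nat) : nat :=
  if n is n'.+1 then \sum_(v <- F n' | edge v w) fstat_rec n' v else 1.

Definition fstat (w : seq nat) : nat := fstat_rec (sumn w) w.

Lemma fstat_nil : fstat [::] = 1.
Proof. by []. Qed.

Lemma fstatE n w : w \in F n.+1 ->
  fstat w = \sum_(v <- F n | edge v w) fstat v.
Proof.
rewrite mem_F /fstat => /andP[_ /eqP ->] /=.
rewrite big_seq_cond [RHS]big_seq_cond; apply: eq_bigr => v /andP[].
by rewrite mem_F => /andP[_ /eqP ->].
Qed.

Definition Fodd (n : nat) : seq (seq nat) := [seq w <- F n | odd (fstat w)].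

Definition mres (k n i : nat) : nat :=
  count (fun w => fstat w == i %[mod 2 ^ k]) (Fodd n).

(* Main.v *)
Require Import Defs.
From mathcomp Require Import all_boot.
From mathcomp Require Import zify.

(** The statistic satisfies [f_{1w} = f_w] and [f_{2w} = (|w| + 1) f_w], so
    [f_w] is the product of [|v| + 1] over the factorizations [w = u2v], and it
    is odd iff every such [|v|] is even.  Hence the odd values of [f] on [F(n)]
    are the products of the subsets of [{1, 3, ..., 2m - 1}], [m = n/2].
    As soon as [a = 2^(k-1) + 1] is one of these factors, the list of products
    is invariant modulo [2^k] under multiplication by [a], because
    [a^2 = 1 mod 2^k].  For odd [s], [a s = s + 2^(k-1) mod 2^k], so each odd
    class modulo [2^(k-1)] splits evenly into its two lifts modulo [2^k], and
    induction on [k] concludes. *)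

Lemma edge_cons1 v w : edge v (1 :: w) = (v == w).
Proof.
rewrite /edge /remove1 /=.
rewrite (_ : change2 v (1 :: w) = false) //; apply/negbTE/hasPn => -[|i] _ //=.
by rewrite andbF.
Qed.

(** Either the leading 2 is the one changed, or it stays and, not being a 1, does not block a change
    further right. *)
Lemma change2_cons2 v w : change2 v (2 :: w) =
  (v == 1 :: w) || (if v is x :: u then (x == 2) && change2 u w else false).
Proof.
rewrite /change2 /= -[1]addn0 iotaDl has_map; congr orb.
case: v => [|x u]; first by apply/hasPn => i _ /=; rewrite !andbF.
case: (x =P 2) => [->|neq] /=.
  by apply: eq_has => i /=; rewrite inE eqseq_cons eqxx.
apply/hasPn => i _ /=; rewrite eqseq_cons.
by case: (x =P 2) => //; rewrite !andbF.
Qed.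

Lemma edge_cons1_cons2 u w : edge (1 :: u) (2 :: w) = (u == w).
Proof.
rewrite /edge /remove1 change2_cons2 /= !eqseq_cons eqxx /= orbF.
by rewrite andbF orbF.
Qed.

Lemma edge_cons2_cons2 u w : edge (2 :: u) (2 :: w) = edge u w.
Proof. by rewrite /edge /remove1 change2_cons2 /= inE !eqseq_cons eqxx. Qed.

Lemma cons1_F n w : w \in F n -> 1 :: w \in F n.+1.
Proof. by rewrite !mem_F /is_word /= => /andP[-> /eqP->] /=; rewrite eqxx. Qed.

Lemma cons2_F n w : w \in F n -> 2 :: w \in F n.+2.
Proof. by rewrite !mem_F /is_word /= => /andP[-> /eqP->] /=; rewrite eqxx. Qed.

Lemma big_F_eq n w : w \in F n -> \sum_(v <- F n | v == w) fstat v = fstat w.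
Proof.
move=> wF; rewrite (big_rem w) //= eqxx big1_seq ?addn0 // => v /andP[/eqP->].
by rewrite mem_rem_uniqF ?uniq_F.
Qed.

Lemma fstat_cons1 n w : w \in F n -> fstat (1 :: w) = fstat w.
Proof.
move=> wF; rewrite (@fstatE n) ?cons1_F //.
by under eq_bigl do rewrite edge_cons1; exact: big_F_eq.
Qed.

(** Below [2 :: w] lie [1 :: w], which contributes $f_w$, and the words [2 :: u] with $u\in w^-$,
    which by induction contribute $n f_u$ each, hence $n f_w$ together. *)
Lemma fstat_cons2 n w : w \in F n -> fstat (2 :: w) = n.+1 * fstat w.
Proof.
elim: n w => [|n IHn] w wF; rewrite (fstatE (cons2_F _ _ wF)).
  by move: wF; rewrite inE => /eqP ->; rewrite big_cons big_nil (fstat_cons1 0).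
rewrite [F n.+2]/= -/(F n.+1) big_cat !big_map /=.
under eq_bigl do rewrite edge_cons1_cons2.
under [X in _ + X]eq_bigl do rewrite edge_cons2_cons2.
have -> : \sum_(u <- F n.+1 | u == w) fstat (1 :: u) = fstat w.
  rewrite -(big_F_eq _ _ wF) big_seq_cond [RHS]big_seq_cond.
  by apply: eq_bigr => u /andP[uF _]; rewrite (fstat_cons1 _ _ uF).
rewrite mulSn; congr addn.
rewrite (fstatE wF) big_distrr big_seq_cond [RHS]big_seq_cond /=.
by apply: eq_bigr => u /andP[uF _]; rewrite IHn.
Qed.

Lemma map_fstat_F n : [seq fstat w | w <- F n.+2] =
  [seq fstat w | w <- F n.+1] ++ [seq n.+1 * fstat w | w <- F n].
Proof.
rewrite [F n.+2]/= -/(F n.+1) map_cat -!map_comp; congr cat; apply/eq_in_map.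
  by move=> w /fstat_cons1.
by move=> w /fstat_cons2.
Qed.

(** Products are kept with multiplicity and in the order induced by [F], so that the comparison with
    [fstat] is an equality of lists. *)
Fixpoint odd_subset_products (m : nat) : seq nat :=
  if m is m'.+1 then
    odd_subset_products m' ++ [seq m'.*2.+1 * s | s <- odd_subset_products m']
  else [:: 1].

Lemma map_fstat_Fodd n : [seq fstat w | w <- Fodd n] =
  [seq s <- [seq fstat w | w <- F n] | odd s].
Proof. by rewrite filter_map. Qed.

Lemma map_fstat_Fodd_rec n : [seq fstat w | w <- Fodd n.+2] =
  [seq fstat w | w <- Fodd n.+1] ++
  (if odd n then [::] else [seq n.+1 * s | s <- [seq fstat w | w <- Fodd n]]).
Proof.
rewrite !map_fstat_Fodd map_fstat_F filter_cat; congr cat.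
rewrite (map_comp (muln n.+1) fstat) filter_map.
case: ifP => odd_n.
  rewrite (eq_filter (a2 := pred0)) ?filter_pred0 // => s.
  by rewrite /= oddM /= odd_n.
by congr map; apply: eq_filter => s; rewrite /= oddM /= odd_n.
Qed.

(** Both parities go together because the recursion reaches back two weights. Prepending a 2 to a
    word of odd weight gives an even factor, so passing from $2m$ to $2m+1$ adds no odd value. *)
Lemma fstat_Fodd_double m :
  [seq fstat w | w <- Fodd m.*2] = odd_subset_products m /\
  [seq fstat w | w <- Fodd m.*2.+1] = odd_subset_products m.
Proof.
elim: m => [|m [IH0 IH1]].
  rewrite !map_fstat_Fodd /= (fstat_cons1 0) // fstat_nil; by split.
have IHd : [seq fstat w | w <- Fodd m.+1.*2] = odd_subset_products m.+1.
  by rewrite doubleS map_fstat_Fodd_rec odd_double IH0 IH1.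
by split=> //; rewrite doubleS map_fstat_Fodd_rec /= odd_double cats0 -doubleS.
Qed.

Lemma fstat_Fodd n : [seq fstat w | w <- Fodd n] = odd_subset_products n./2.
Proof.
have [even_eq odd_eq] := fstat_Fodd_double n./2.
by rewrite -[in LHS](odd_double_half n); case: (odd n).
Qed.

Lemma mres_odd_subset_products k n i :
  mres k n i = count (fun s => s == i %[mod 2 ^ k]) (odd_subset_products n./2).
Proof. by rewrite -fstat_Fodd count_map. Qed.

Lemma odd_odd_subset_products m s : s \in odd_subset_products m -> odd s.
Proof.
elim: m s => [|m IHm] s /=; first by rewrite inE => /eqP ->.
rewrite mem_cat => /orP[/IHm //|/mapP[t /IHm odd_t ->]].
by rewrite oddM /= odd_double odd_t.
Qed.

Lemma size_odd_subset_products m : size (odd_subset_products m) = 2 ^ m.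
Proof.
by elim: m => //= m IHm; rewrite size_cat size_map IHm addnn -mul2n expnS.
Qed.

(** With $a=2j+1$, multiplication by $a$ exchanges, modulo $d$, the products without the factor $a$
    and those with it. [P] is arbitrary because the induction also applies to $s\mapsto
    P((2m+1)s)$. *)
Lemma count_odd_subset_products_mul d m j (P : pred nat) :
  j < m -> (forall s t, s = t %[mod d] -> P s = P t) ->
  j.*2.+1 * j.*2.+1 = 1 %[mod d] ->
  count (fun s => P (j.*2.+1 * s)) (odd_subset_products m) =
  count P (odd_subset_products m).
Proof.
move=> + + sqr1; elim: m P => // m IHm P; rewrite ltnS leq_eqVlt => ltjm Pmod.
rewrite /= !count_cat !count_map.
case/orP: ltjm => [/eqP <- | ltjm].
  rewrite addnC; congr addn; apply: eq_count => s /=; apply: Pmod.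
  by rewrite mulnA -modnMml sqr1 modnMml mul1n.
rewrite IHm //; congr addn.
rewrite -(IHm (fun s => P (m.*2.+1 * s))) //.
  by apply: eq_count => s /=; rewrite mulnCA.
by move=> s t eq_st; apply: Pmod; rewrite -modnMmr eq_st modnMmr.
Qed.

Lemma modn_double_lt h x : x < 2 * h -> x %% h = if x < h then x else x - h.
Proof.
move=> ltx; case: ltnP => [ltxh|lehx]; first by rewrite modn_small.
by rewrite -[in LHS](subnK lehx) modnDr modn_small //; lia.
Qed.

(** Since $(h+1)s\equiv s+h$ modulo $2h$ for odd $s$, the numbers $s$ and $(h+1)s$ represent the two
    lifts of $s$ modulo $h$. Truth values are added as numbers so that the identity can be summed
    over a list. *)
Lemma lift_mod_double h s i : 0 < h -> odd s ->
  (s == i %[mod 2 * h]) + (h.+1 * s == i %[mod 2 * h]) = (s == i %[mod h]).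
Proof.
move=> h_gt0 odd_s.
have mulE : h.+1 * s = s + h %[mod 2 * h].
  have [t ->] : exists t, s = t.*2.+1.
    by exists s./2; rewrite -{1}(odd_double_half s) odd_s.
  rewrite (_ : h.+1 * _ = t * (2 * h) + (t.*2.+1 + h)); last by lia.
  by rewrite modnMDl.
rewrite mulE -(modnDml s) -(@modn_dvdm (2 * h) s h) ?dvdn_mull //.
rewrite -(@modn_dvdm (2 * h) i h) ?dvdn_mull //.
have := ltn_pmod i (d := 2 * h); have := ltn_pmod s (d := 2 * h).
move: (s %% _) (i %% _) => x y; rewrite muln_gt0 h_gt0 => /(_ isT) ltx /(_ isT) lty.
have -> : (x + h) %% (2 * h) = if x < h then x + h else x - h.
  case: ltnP => [ltxh|lehx]; first by rewrite modn_small //; lia.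
  rewrite (_ : x + h = x - h + 2 * h); last by lia.
  by rewrite modnDr modn_small //; lia.
rewrite !modn_double_lt //.
by case: (ltnP x h) => ?; case: (ltnP y h) => ?; repeat case: (_ =P _); lia.
Qed.

(** There are $2^k$ odd classes modulo $2^{k+1}$, and each receives an equal share of the $2^m$
    products. The induction starts at modulus 2, where all products are congruent. *)
Lemma count_odd_subset_products k m i : odd i -> 2 ^ k < m.*2 ->
  2 ^ k * count (fun s => s == i %[mod 2 ^ k.+1]) (odd_subset_products m) =
  2 ^ m.
Proof.
move=> odd_i; elim: k => [_|k IHk ltkm].
  rewrite mul1n -(size_odd_subset_products m); apply/eqP; rewrite -all_count.
  apply/allP => s /odd_odd_subset_products odd_s.
  by rewrite !modn2 odd_i odd_s.
have ltk : 2 ^ k < m.*2 by apply: leq_ltn_trans ltkm; rewrite leq_exp2l.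
rewrite -[RHS](IHk ltk) {1}expnSr -mulnA; congr muln.
have eq2k : (2 ^ k).*2.+1 = (2 ^ k.+1).+1 by rewrite expnS mul2n.
rewrite mul2n -addnn.
(* The choice $j=2^k$ makes the factor $2j+1=2^{k+1}+1$, which is $h+1$ for $h=2^{k+1}$; one of the
   two copies of the count is twisted by it. *)
rewrite -{2}(count_odd_subset_products_mul (2 ^ k.+2) _ (2 ^ k)); last first.
- rewrite eq2k (_ : _ * _ = (2 ^ k.+1).+2 * 2 ^ k.+1 + 1); last by lia.
  rewrite [X in X.+2 * _]expnS (_ : _ + 1 = (2 ^ k).+1 * 2 ^ k.+2 + 1).
    by rewrite modnMDl.
  by rewrite !expnS; lia.
- by move=> s t eq_st; rewrite eq_st.
- by move: ltkm; rewrite expnS mul2n ltn_double.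
rewrite eq2k -!sum1_count !(big_mkcond (fun _ => _ == _)) -big_split /=.
rewrite big_seq [RHS]big_seq; apply: eq_bigr => s /odd_odd_subset_products odd_s.
have := lift_mod_double (2 ^ k.+1) s i _ odd_s.
rewrite -expnS expn_gt0 => /(_ isT).
by do 3 case: (_ == _).
Qed.

Theorem mainTheorem8 (k n : nat) (hk : 1 <= k) (hn : 2 ^ (k - 1) + 2 <= n)
    (i j : nat) (hi : odd i) (hi1 : 1 <= i <= 2 ^ k - 1)
    (hj : odd j) (hj1 : 1 <= j <= 2 ^ k - 1) :
  mres k n i = mres k n j.
Proof.
case: k hk hn {hi1 hj1} => // k _; rewrite subn1 /= => hn.
(* Here [k] is the original exponent minus one. Rounding [n] down to an even number loses at most 1,
   which the summand 2 in the bound absorbs. *)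
have ltkn : 2 ^ k < n./2.*2 by have := odd_double_half n; lia.
rewrite !mres_odd_subset_products; apply/eqP.
by rewrite -(@eqn_pmul2l (2 ^ k)) ?expn_gt0 // !count_odd_subset_products.
Qed.
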